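(* Suppose the generalized LBB condition holds: there is a constant $c>0$ independent of $h$ such that $$c\,\|\nabla q_h\|_{\mathbf{L}^2}\le \sup_{0\ne v_h\in\mathbf{X}_h}\frac{\int_\Omega(\nabla\cdot v_h)\,q_h}{\|v_h\|_{\mathbf{L}^2}}\quad\text{for all } q_h\in M_h.$$ Then for each $h$ there exists a Fortin projection $\mathcal{F}_h:\mathbf{H}^1_0(\Omega)\to\mathbf{X}_h$ satisfying, with a constant $c'$ independent of $h$, $$\|v-\mathcal{F}_hv\|_{\mathbf{L}^2}\le c'\,h\,\|v\|_{\mathbf{H}^1}\quad\text{for all } v\in\mathbf{H}^1_0(\Omega).$$
   Context: $\Omega\subset\mathbb{R}^d$, $d\in\{2,3\}$, is a bounded open domain with Lipschitz boundary. Bold symbols denote spaces of $\mathbb{R}^d$-valued functions: $\mathbf{L}^2=L^2(\Omega)^d$, $\mathbf{H}^1=H^1(\Omega)^d$, $\mathbf{H}^1_0(\Omega)=H^1_0(\Omega)^d$. $L^2_{\int=0}(\Omega)$ is the set of functions in $L^2(\Omega)$ with mean zero. $\{\mathcal{T}_h\}_h$ is a family of conforming, shape-regular and quasi-uniform triangulations of $\Omega$ with mesh size $h>0$. $\mathbf{X}_h\subset\mathbf{H}^1_0(\Omega)$ and $M_h\subset L^2_{\int=0}(\Omega)\cap H^1(\Omega)$ are finite dimensional spaces constructed on $\mathcal{T}_h$ (for instance by finite elements). Standing assumptions, with constants $c$ independent of $h$: (i) $\|v_h\|_{\mathbf{H}^1}\le c h^{-1}\|v_h\|_{\mathbf{L}^2}$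 for all $v_h\in\mathbf{X}_h$, and $\|q_h\|_{H^1}\le c h^{-1}\|q_h\|_{L^2}$ for all $q_h\in M_h$; (ii) there is an operator (the Scott-Zhang interpolation operator) $\mathcal{C}_h:\mathbf{H}^1_0(\Omega)\to\mathbf{X}_h$ with $\|v-\mathcal{C}_hv\|_{\mathbf{L}^2}+h\|\mathcal{C}_hv\|_{\mathbf{H}^1}\le c h\|v\|_{\mathbf{H}^1}$ for all $v\in\mathbf{H}^1_0(\Omega)$. Definition: an operator $\mathcal{F}_h:\mathbf{H}^1_0(\Omega)\to\mathbf{X}_h$ is called a Fortin projection if $\mathcal{F}_h^2=\mathcal{F}_h$ and $\int_\Omega\nabla\cdot(v-\mathcal{F}_hv)\,q_h=0$ for all $v\in\mathbf{H}^1_0(\Omega)$ and all $q_h\in M_h$. *)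

(* Defs.v *)
From HB Require Import structures.
From mathcomp Require Import all_boot all_order all_algebra.
From mathcomp Require Import all_classical all_reals all_analysis.

Set Implicit Arguments.
Unset Strict Implicit.
Unset Printing Implicit Defensive.

Import Order.TTheory GRing.Theory Num.Theory.
Import numFieldNormedType.Exports.

Local Open Scope classical_set_scope.
Local Open Scope ring_scope.

Section row_vector_measurable.
Context {R : realType} (n : nat).

(* The Borel sigma-algebra of R^n, generated by the coordinate functions. *)
Definition rV_coord (i : 'I_n) (x : 'rV[R]_n) : measurableTypeR R := x ord0 i.

Let rV_set0 : g_sigma_preimage rV_coord set0.
Proof. exact: sigma_algebra0. Qed.

Let rV_setC A : g_sigma_preimage rV_coord A -> g_sigma_preimage rV_coord (~` A).
Proof. exact: sigma_algebraC. Qed.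

Let rV_bigcup (F : (set 'rV[R]_n)^nat) :
  (forall i, g_sigma_preimage rV_coord (F i)) ->
  g_sigma_preimage rV_coord (\bigcup_i (F i)).
Proof. exact: sigma_algebra_bigcup. Qed.

HB.instance Definition _ := @isMeasurable.Build
  (measure_tuple_display (sigma_display (@ocitv R)))
  'rV[R]_n (g_sigma_preimage rV_coord) rV_set0 rV_setC rV_bigcup.

End row_vector_measurable.

Section row_vector_measure.
Context {R : realType}.

Definition rV_cons n (p : measurableTypeR R * 'rV[R]_n) : 'rV[R]_n.+1 :=
  \row_i oapp (p.2 ord0) p.1 (unlift ord0 i).

Definition rV_uncons n (x : 'rV[R]_n.+1) : measurableTypeR R * 'rV[R]_n :=
  (x ord0 ord0, \row_i x ord0 (lift ord0 i)).

Lemma rV_consK n : cancel (@rV_cons n) (@rV_uncons n).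
Proof.
case=> a u; rewrite /rV_cons /rV_uncons mxE unlift_none /=; congr pair.
by apply/rowP => i; rewrite !mxE liftK.
Qed.

Lemma measurable_rV_coord n (i : 'I_n) :
  measurable_fun [set: 'rV[R]_n] (rV_coord i).
Proof.
move=> _ Y mY; rewrite setTI; apply: sub_sigma_algebra => /=.
rewrite -bigcup_seq/=; exists i => /=; first by rewrite mem_index_enum.
by exists Y => //; rewrite setTI.
Qed.

Lemma measurable_fun_rV d (T : measurableType d) n (f : T -> 'rV[R]_n) :
  (forall i, measurable_fun [set: T] (rV_coord i \o f)) ->
  measurable_fun [set: T] f.
Proof.
move=> mf; suff H : g_sigma_preimage (fun i => rV_coord i \o f) `<=` measurable.
  move=> _ B mB; rewrite setTI; apply: H.
  by rewrite g_sigma_preimage_comp; exists B => //; rewrite setTI.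
apply: smallest_sub; first exact: sigma_algebra_measurable.
case: n => [|n] in f mf *; first by rewrite big_ord0.
rewrite -bigcup_mkord_ord; apply: bigcup_sub => i Ii.
by move=> A [B mB <-]; exact: mf.
Qed.

Lemma measurable_rV_cons n :
  measurable_fun [set: measurableTypeR R * 'rV[R]_n] (@rV_cons n).
Proof.
apply: measurable_fun_rV => i; case: (unliftP ord0 i) => [j|] ->.
  rewrite (_ : _ \o _ = rV_coord j \o snd).
    by apply: measurableT_comp => //; exact: measurable_rV_coord.
  by apply/funext => p; rewrite /rV_cons /rV_coord /= mxE liftK.
rewrite (_ : _ \o _ = fst) //.
by apply/funext => p; rewrite /rV_cons /rV_coord /= mxE unlift_none.
Qed.

Lemma measurable_rV_uncons n :
  measurable_fun [set: 'rV[R]_n.+1] (@rV_uncons n).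
Proof.
apply: measurable_fun_pair; first exact: measurable_rV_coord.
apply: measurable_fun_rV => i.
rewrite (_ : _ \o _ = rV_coord (lift ord0 i)); first exact: measurable_rV_coord.
by apply/funext => x; rewrite /rV_coord /= mxE.
Qed.

Lemma product_sigma_finite d1 d2 (T1 : measurableType d1)
    (T2 : measurableType d2) (m1 : {sigma_finite_measure set T1 -> \bar R})
    (m2 : {sigma_finite_measure set T2 -> \bar R}) :
  sigma_finite setT (m1 \x m2)%E.
Proof.
have /sigma_finiteP[F [TF ndF Foo]] := sigma_finiteT m1.
have /sigma_finiteP[G [TG ndG Goo]] := sigma_finiteT m2.
exists (fun n => F n `*` G n).
  rewrite -setXTT TF TG predeqE => -[x y]; split.
    move=> [/= [n _ Fnx] [k _ Gky]]; exists (maxn n k) => //; split.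
    - by move: x Fnx; exact/subsetPset/ndF/leq_maxl.
    - by move: y Gky; exact/subsetPset/ndG/leq_maxr.
  by move=> [n _ []/= ? ?]; split; exists n.
move=> k; have [? ?] := Foo k; have [? ?] := Goo k.
split; first exact: measurableX.
by rewrite product_measure1E// lte_mul_pinfty// ge0_fin_numE.
Qed.

Section cons_measure.
Context n (mu : {sigma_finite_measure set 'rV[R]_n -> \bar R}).

Definition rV_cons_measure : set 'rV[R]_n.+1 -> \bar R :=
  pushforward (lebesgue_measure \x mu)%E (@rV_cons n).

Let rV_cons_measurable (A : set 'rV[R]_n.+1) :
  measurable A -> measurable (@rV_cons n @^-1` A).
Proof. by move=> mA; rewrite -[X in measurable X]setTI; exact: measurable_rV_cons. Qed.

Let rV_cons_measure0 : rV_cons_measure set0 = 0%E.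
Proof. by rewrite /rV_cons_measure /pushforward preimage_set0 measure0. Qed.

Let rV_cons_measure_ge0 A : (0 <= rV_cons_measure A)%E.
Proof. by rewrite /rV_cons_measure /pushforward; exact: measure_ge0. Qed.

Let rV_cons_measure_sigma_additive : semi_sigma_additive rV_cons_measure.
Proof.
move=> F mF tF mUF; rewrite /rV_cons_measure /pushforward preimage_bigcup.
apply: measure_semi_sigma_additive.
- by move=> k; exact: rV_cons_measurable.
- apply/trivIsetP => /= i j _ _ ij; rewrite -preimage_setI.
  by move/trivIsetP : tF => /(_ _ _ _ _ ij) ->//; rewrite preimage_set0.
- by rewrite -preimage_bigcup; exact: rV_cons_measurable.
Qed.

HB.instance Definition _ := isMeasure.Build _ _ _ rV_cons_measure
  rV_cons_measure0 rV_cons_measure_ge0 rV_cons_measure_sigma_additive.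

Let rV_cons_measure_sigma_finite : sigma_finite setT rV_cons_measure.
Proof.
have [F TF Foo] : sigma_finite setT (lebesgue_measure \x mu)%E.
  exact: product_sigma_finite.
exists (fun k => @rV_uncons n @^-1` F k).
  by rewrite -preimage_bigcup -TF preimage_setT.
move=> k; have [mF Fk] := Foo k; split.
  by rewrite -[X in measurable X]setTI; exact: measurable_rV_uncons.
rewrite /rV_cons_measure /pushforward (_ : _ @^-1` _ = F k) //.
by rewrite -comp_preimage; apply/seteqP; split => p; rewrite /= rV_consK.
Qed.

HB.instance Definition _ := Measure_isSigmaFinite.Build _ _ _ rV_cons_measure
  rV_cons_measure_sigma_finite.

End cons_measure.

(* Lebesgue measure on R^n: the n-fold product of the one-dimensional one. *)
Fixpoint leb n : {sigma_finite_measure set 'rV[R]_n -> \bar R} :=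
  match n with
  | 0 => (\d_(0 : 'rV[R]_0))
  | m.+1 => rV_cons_measure (leb m)
  end.

End row_vector_measure.

Section euclidean.
Context {R : realType}.

Definition enorm n (x : 'rV[R]_n) : R := Num.sqrt (\sum_i x ord0 i ^+ 2).

(* The ambient topology on 'rV[R]_n is that of the (equivalent) max norm; the
   geometric quantities below are Euclidean. *)
Definition eball n (x : 'rV[R]_n) (r : R) : set 'rV[R]_n :=
  [set y | enorm (y - x) < r].

Definition diam n (A : set 'rV[R]_n) : R :=
  sup [set enorm (x - y) | x in A & y in A].

(* Diameter of the largest Euclidean ball contained in A. *)
Definition indiam n (A : set 'rV[R]_n) : R :=
  sup [set 2 * r | r in [set r | 0 < r /\ exists x, eball x r `<=` A]].

(* Locally, after an orthogonal change of coordinates y = x *m Q, the set Om is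
   the strict epigraph in direction i of a Lipschitz function of the remaining
   n - 1 coordinates col' i y. *)
Definition lipschitz_boundary n (Om : set 'rV[R]_n) : Prop :=
  forall x0, (closure Om `\` Om) x0 ->
  exists (r : R) (Q : 'M[R]_n) (i : 'I_n) (g : 'rV[R]_n.-1 -> R),
    [/\ 0 < r,
        Q *m Q^T = 1%:M,
        (exists L : R, forall u w, `|g u - g w| <= L * enorm (u - w)) &
        Om `&` eball x0 r =
        [set x | g (col' i (x *m Q)) < (x *m Q) ord0 i] `&` eball x0 r].

Definition bounded_lipschitz_domain n (Om : set 'rV[R]_n) : Prop :=
  [/\ Om !=set0, open Om, connected Om, bounded_set Om &
      lipschitz_boundary Om].

End euclidean.

Section triangulations.
Context {R : realType} (d : nat).

(* A simplex is given by its d + 1 vertices, the rows of K. *)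
Implicit Types (K L : 'M[R]_(d.+1, d)) (Th : seq 'M[R]_(d.+1, d)).

Definition nondegenerate K : Prop :=
  (\matrix_(i < d) (row (lift ord0 i) K - row ord0 K)) \in unitmx.

(* The closed face spanned by the vertices with index in S. *)
Definition face K (S : {set 'I_d.+1}) : set 'rV[R]_d :=
  [set x | exists t : 'I_d.+1 -> R,
     [/\ forall i, 0 <= t i, forall i, i \notin S -> t i = 0,
         \sum_i t i = 1 & x = \sum_i t i *: row i K]].

Definition simplex K : set 'rV[R]_d := face K [set: 'I_d.+1]%SET.

Definition conforming_triangulation (Om : set 'rV[R]_d) Th : Prop :=
  [/\ forall K, K \in Th -> nondegenerate K,
      closure Om = [set x | exists2 K, K \in Th & simplex K x] &
      forall K L, K \in Th -> L \in Th -> exists S S' : {set 'I_d.+1},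
        simplex K `&` simplex L = face K S /\
        simplex K `&` simplex L = face L S'].

Definition mesh_size Th (h : R) : Prop :=
  (forall K, K \in Th -> diam (simplex K) <= h) /\
  (exists2 K, K \in Th & diam (simplex K) = h).

(* A family of meshes indexed by its set H of mesh sizes. *)
Definition triangulation_family (Om : set 'rV[R]_d) (H : set R)
    (T : R -> seq 'M[R]_(d.+1, d)) : Prop :=
  [/\ forall h, H h ->
        [/\ 0 < h, conforming_triangulation Om (T h) & mesh_size (T h) h],
      (* shape regularity *)
      exists2 s : R, 0 < s & forall h K, H h -> K \in T h ->
        diam (simplex K) <= s * indiam (simplex K) &
      (* quasi-uniformity *)
      exists2 s : R, 0 < s & forall h K, H h -> K \in T h ->
        h <= s * diam (simplex K)].

End triangulations.

(* Elements of the Lebesgue and Sobolev spaces on Om are represented by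
   functions on the whole of R^d of which only the values on Om matter; equality
   in these spaces is equality almost everywhere on Om. *)
Section sobolev.
Context {R : realType} (d : nat) (Om : set 'rV[R]_d).
Local Notation E := 'rV[R]_d.
Implicit Types (f g q : E -> R) (v w : E -> E).

Definition aeq (V : Type) (f g : E -> V) : Prop := ae_eq (leb d) Om f g.

Definition L2 f : Prop := (f \_ Om) \in Lfun (leb d) 2%:E.

Definition L2norm f : R := fine ('N[leb d]_2%:E[EFin \o (f \_ Om)])%E.

Definition partial (i : 'I_d) f : E -> R := fun x => 'D_(delta_mx ord0 i) f x.

(* All iterated partial derivatives exist and are continuous. *)
Definition smooth f : Prop := forall s : seq 'I_d,
  let D := foldr partial f s in
  continuous D /\ forall i x, derivable D x (delta_mx ord0 i).

(* C_c^oo(Om) *)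
Definition test_function f : Prop :=
  let supp := closure [set x | f x != 0] in
  [/\ smooth f, compact supp & supp `<=` Om].

Definition is_wpartial (i : 'I_d) f g : Prop :=
  forall p, test_function p ->
  \int[leb d]_(x in Om) (f x * partial i p x) =
  - \int[leb d]_(x in Om) (g x * p x).

Definition H1 f : Prop :=
  L2 f /\ forall i, exists2 g, L2 g & is_wpartial i f g.

(* The i-th weak derivative, well defined up to equality almost everywhere
   when f is in H1. *)
Definition wpartial (i : 'I_d) f : E -> R :=
  get [set g | L2 g /\ is_wpartial i f g].

Definition H1norm f : R :=
  Num.sqrt (L2norm f ^+ 2 + \sum_i L2norm (wpartial i f) ^+ 2).

(* Closure of C_c^oo(Om) in H1. *)
Definition H10 f : Prop :=
  H1 f /\ forall e : R, 0 < e -> exists p, [/\ test_function p,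
    L2norm (f \- p) < e &
    forall i, L2norm (wpartial i f \- partial i p) < e].

Definition mean_zero_L2 q : Prop := L2 q /\ \int[leb d]_(x in Om) q x = 0.

Definition comp v (i : 'I_d) : E -> R := fun x => v x ord0 i.

Definition vL2norm v : R := Num.sqrt (\sum_i L2norm (comp v i) ^+ 2).

Definition vH1norm v : R := Num.sqrt (\sum_i H1norm (comp v i) ^+ 2).

Definition vH10 v : Prop := forall i, H10 (comp v i).

Definition grad q : E -> E := fun x => \row_i wpartial i q x.

Definition div v : E -> R := fun x => \sum_i wpartial i (comp v i) x.

Definition fin_dim_subspace (V : lmodType R) (X : set V) : Prop :=
  exists (n : nat) (e : 'I_n -> V),
    X = [set u | exists a : 'I_n -> R, u = \sum_i a i *: e i].

(* An operator from H10^d to X, well defined on classes modulo equality almost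
   everywhere. *)
Definition operator (X : set (E -> E)) (F : (E -> E) -> (E -> E)) : Prop :=
  (forall v, vH10 v -> X (F v)) /\
  (forall v w, vH10 v -> vH10 w -> aeq v w -> aeq (F v) (F w)).

Definition linear_operator (X : set (E -> E)) (F : (E -> E) -> (E -> E)) :
    Prop :=
  operator X F /\
  forall (a : R) v w, vH10 v -> vH10 w ->
    aeq (F (a *: v + w)) (a *: F v + F w).

(* By linearity of the weak divergence, div (v - F v) is div v - div (F v). *)
Definition fortin_projection (X : set (E -> E)) (M : set (E -> R))
    (F : (E -> E) -> (E -> E)) : Prop :=
  [/\ linear_operator X F,
      forall v, vH10 v -> aeq (F (F v)) (F v) &
      forall v q, vH10 v -> M q ->
        \int[leb d]_(x in Om) ((div v x - div (F v) x) * q x) = 0].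

(* For a finite dimensional X in H10^d this set of quotients is bounded above,
   so that the real supremum is the usual one; it is 0 when X is trivial. *)
Definition lbb_sup (X : set (E -> E)) q : R :=
  sup [set (\int[leb d]_(x in Om) (div v x * q x)) / vL2norm v
      | v in [set v | X v /\ ~ aeq v 0]].

End sobolev.

(* Main.v *)
Require Import Defs.
From mathcomp Require Import all_boot all_order all_algebra.
From mathcomp Require Import all_classical all_reals all_analysis.
From mathcomp Require Import measurable_realfun ring lra.

Set Implicit Arguments.
Unset Strict Implicit.
Unset Printing Implicit Defensive.

Import Order.TTheory GRing.Theory Num.Theory.
Import numFieldNormedType.Exports.
Local Open Scope classical_set_scope.
Local Open Scope ring_scope.

(** The operator is the L2-orthogonal projection of v onto the affine space of
    those x in X_h with the same discrete divergence as v, that is with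
    int (div x) q = int (div v) q for all q in M_h.

    Let P be the L2-projection onto X_h. For v in H10 and q in H1, integration
    by parts turns int (div v) q into - (v, grad q), so the constraints are L2
    pairings with the gradients of a spanning family f_j of M_h, and on X_h
    they are pairings with the vectors r_j = P (grad f_j). The projection is
    F v = P v + k, where k is the combination of the r_j with
    (k, r_j) = (v - P v, grad f_j) for all j. For a combination q of the f_j,
    the supremum in the generalized LBB condition is the L2 norm of
    P (grad q), so that condition says c |grad q| <= |P (grad q)|. Hence, for
    u = v - P v,
      |(u, grad q)| <= |u| |grad q| <= c^-1 |u| |P (grad q)|.
    This makes the system for k solvable, and taking for q the combination
    with P (grad q) = k it gives |k| <= c^-1 |u|. As P is a best
    approximation,
      |v - F v| <= (1 + c^-1) |v - x|   for every x in X_h.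
    With x = v, for v in X_h, this yields F (F v) = F v; with x = C_h v it
    yields the estimate of order h.
    The interpolant C_h enters only as a competitor in this bound, so F is
    linear although C_h is an arbitrary operator.

    The algebra is [constrained_projection], stated for a semidefinite form
    because functions are only identified almost everywhere. The analysis is
    [div_parts], which follows from the density of test functions in H10; it
    needs test functions and their derivatives to be square integrable on
    Om, hence that open sets of R^d are measurable and bounded ones have
    finite measure. *)

(** * Projections for a positive semidefinite form *)

(** A positive semidefinite symmetric form ip on a linear subspace D of V.
    Outside D the form is arbitrary except for symmetry: an integral of a
    product makes sense for all functions, but is bilinear only on L2. *)
Record semi_inner {R : realType} {V : lmodType R} (D : set V)
    (ip : V -> V -> R) : Prop := SemiInner {
  dom0 : D 0;
  domP : forall a u v, D u -> D v -> D (a *: u + v);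
  ip_linear : forall a u v w, D u -> D v -> D w ->
    ip (a *: u + v) w = a * ip u w + ip v w;
  ip_sym : forall u v, ip u v = ip v u;
  ip_ge0 : forall u, D u -> 0 <= ip u u }.

Section semi_inner_theory.
Context {R : realType} {V : lmodType R} {D : set V} (ip : V -> V -> R).
Hypothesis S : semi_inner D ip.

Definition lincomb {W : lmodType R} n (e : 'I_n -> W) (a : 'rV[R]_n) : W :=
  \sum_i a ord0 i *: e i.

Lemma lincombP {W : lmodType R} n (e : 'I_n -> W) k a b :
  lincomb e (k *: a + b) = k *: lincomb e a + lincomb e b.
Proof.
rewrite /lincomb scaler_sumr -big_split; apply: eq_bigr => i _ /=.
by rewrite !mxE scalerDl scalerA.
Qed.

Definition nrm (u : V) := Num.sqrt (ip u u).

Lemma domD u v : D u -> D v -> D (u + v).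
Proof. by move=> Du Dv; rewrite -[u]scale1r; exact: (domP S). Qed.

Lemma domZ a u : D u -> D (a *: u).
Proof. by move=> Du; rewrite -[_ *: _]addr0; apply: (domP S) => //; exact: (dom0 S). Qed.

Lemma domB u v : D u -> D v -> D (u - v).
Proof. by move=> Du Dv; rewrite -scaleN1r; apply: domD => //; exact: domZ. Qed.

Lemma dom_lincomb n (e : 'I_n -> V) a : (forall i, D (e i)) -> D (lincomb e a).
Proof.
move=> De; apply: (big_ind D); [exact: (dom0 S)|exact: domD|].
by move=> i _; exact: domZ.
Qed.

Lemma ipDl u v w : D u -> D v -> D w -> ip (u + v) w = ip u w + ip v w.
Proof. by move=> *; rewrite -[u]scale1r (ip_linear S)// scale1r mul1r. Qed.

Lemma ip0l w : D w -> ip 0 w = 0.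
Proof. by move=> Dw; have D0 := dom0 S; apply: (addrI (ip 0 w)); rewrite -ipDl// !addr0. Qed.

Lemma ipZl a u w : D u -> D w -> ip (a *: u) w = a * ip u w.
Proof.
move=> Du Dw; have D0 := dom0 S.
by rewrite -[a *: u]addr0 (ip_linear S)// ip0l// addr0.
Qed.

Lemma ipBl u v w : D u -> D v -> D w -> ip (u - v) w = ip u w - ip v w.
Proof.
by move=> *; rewrite -scaleN1r ipDl// ?ipZl ?mulN1r//; exact: domZ.
Qed.

Lemma ipDr u v w : D u -> D v -> D w -> ip w (u + v) = ip w u + ip w v.
Proof. by move=> *; rewrite !(ip_sym S w) ipDl. Qed.

Lemma ipZr a u w : D u -> D w -> ip w (a *: u) = a * ip w u.
Proof. by move=> *; rewrite !(ip_sym S w) ipZl. Qed.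

Lemma ip_lincombl n (e : 'I_n -> V) a w : (forall i, D (e i)) -> D w ->
  ip (lincomb e a) w = \sum_i a ord0 i * ip (e i) w.
Proof.
move=> De Dw; pose K x y := D x /\ ip x w = y.
suff [] : K (lincomb e a) (\sum_i a ord0 i * ip (e i) w) by [].
apply: (big_ind2 K).
- by split; [exact: (dom0 S)|exact: ip0l].
- by move=> x1 y1 x2 y2 [? <-] [? <-]; split; [exact: domD|rewrite ipDl].
- by move=> i _; split; [exact: domZ|rewrite ipZl].
Qed.

Lemma nrm_ge0 u : 0 <= nrm u. Proof. exact: sqrtr_ge0. Qed.

Lemma nrm_sqr u : D u -> nrm u ^+ 2 = ip u u.
Proof. by move=> Du; rewrite sqr_sqrtr// (ip_ge0 S). Qed.

Lemma cauchy_schwarz u v : D u -> D v -> `|ip u v| <= nrm u * nrm v.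
Proof.
move=> Du Dv.
have key t : 0 <= ip u u + 2 * t * ip u v + t ^+ 2 * ip v v.
  have Dt : D (u + t *: v) by apply: domD => //; exact: domZ.
  have Dtv := domZ t Dv; have := ip_ge0 S Dt.
  rewrite ipDl// !ipDr// !ipZl// !ipZr// (ip_sym S v u) => h.
  by apply: le_trans h _; rewrite le_eqVlt; apply/orP; left; apply/eqP; ring.
rewrite -sqrtrM ?(ip_ge0 S)// -sqrtr_sqr ler_wsqrtr//.
have := ip_ge0 S Dv; rewrite le0r => /predU1P[v0|v0].
- rewrite v0 mulr0; suff -> : ip u v = 0 by rewrite expr0n.
  apply/eqP/negP => /negP uv0.
  (* Here key is affine in t; at this t its value would be - 1. *)
  have := key (- (1 + ip u u) / (2 * ip u v)); rewrite v0 mulr0 addr0.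
  rewrite [2 * _ * _](_ : _ = - (1 + ip u u)); last by field.
  lra.
(* The minimum of the quadratic polynomial in t. *)
- have := key (- ip u v / ip v v).
  rewrite (_ : _ + _ = (ip u u * ip v v - ip u v ^+ 2) / ip v v); last first.
    by field; rewrite gt_eqF.
  by rewrite pmulr_lge0 ?invr_gt0// subr_ge0.
Qed.

Lemma nrmD u v : D u -> D v -> nrm (u + v) <= nrm u + nrm v.
Proof.
move=> Du Dv; rewrite -(@ler_pXn2r _ 2)// ?nnegrE ?addr_ge0 ?nrm_ge0//.
have Duv := domD Du Dv.
rewrite nrm_sqr// ipDl// !ipDr// (ip_sym S v u).
rewrite sqrrD !nrm_sqr//; have := cauchy_schwarz Du Dv.
have := ler_norm (ip u v); lra.
Qed.

Lemma pythagoras_le u v : D u -> D v -> ip u v = 0 -> nrm u <= nrm (u + v).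
Proof.
move=> Du Dv uv0; rewrite ler_wsqrtr//; have Duv := domD Du Dv.
rewrite ipDl// !ipDr// (ip_sym S v u) uv0.
have := ip_ge0 S Dv; lra.
Qed.

(** Representation of a linear functional on the span of e, given by its values
    l on the e i, which need not be independent. With G the Gram matrix, l has
    a representative iff it lies in the row space of G, that is iff it kills
    the kernel of G, and that kernel consists of the null combinations. The
    coefficients l *m P depend linearly on l, as linearity of the projections
    built from them requires. *)
Lemma riesz n (e : 'I_n -> V) : (forall i, D (e i)) ->
  exists P : 'M[R]_n, forall l : 'rV[R]_n,
    (forall a, nrm (lincomb e a) = 0 -> \sum_i a ord0 i * l ord0 i = 0) ->
    forall i, ip (lincomb e (l *m P)) (e i) = l ord0 i.
Proof.
move=> De; pose G : 'M[R]_n := \matrix_(i, j) ip (e i) (e j).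
exists (pinvmx G) => l lker i.
have GE a j : (a *m G) ord0 j = ip (lincomb e a) (e j).
  by rewrite ip_lincombl// mxE; apply: eq_bigr => k _; rewrite mxE.
rewrite -GE mulmxKpV//.
have GT : G^T = G by apply/matrixP => r s; rewrite !mxE (ip_sym S).
rewrite submxE; apply/eqP/rowP => k; rewrite [RHS]mxE.
pose a : 'rV[R]_n := (col k (cokermx G))^T.
have aG : a *m G = 0.
  by rewrite -GT -trmx_mul colE mulmxA mulmx_coker mul0mx trmx0.
have a0 : nrm (lincomb e a) = 0.
  rewrite /nrm (_ : ip _ _ = 0) ?sqrtr0// (ip_lincombl a De); last exact: dom_lincomb.
  by apply: big1 => j _; rewrite (ip_sym S) -GE aG [X in _ * X]mxE mulr0.
by rewrite -(lker _ a0) mxE; apply: eq_bigr => j _; rewrite !mxE mulrC.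
Qed.

(** For v in K, F v is a closest point to v in the span of e among those that have the same
    pairings with all the g j as v.
    In the application g j is the gradient of f j and N y is the norm of the
    gradient of the combination of the f j with coefficients y. That gradient
    is kept apart from the combination of the g j, since the two only need to
    have the same pairings with K; so the Cauchy-Schwarz bound becomes the
    fifth hypothesis. The last hypothesis is the inf-sup condition, the
    supremum being replaced by its upper bounds. *)
Lemma constrained_projection n m (e : 'I_n -> V) (g : 'I_m -> V)
    (K : set V) (N : 'rV[R]_m -> R) (c : R) :
  (forall i, D (e i)) -> (forall j, D (g j)) -> K `<=` D -> 0 < c ->
  (forall v (a : 'rV[R]_n) (y : 'rV[R]_m), K v ->
    `|\sum_j y ord0 j * ip (v - lincomb e a) (g j)|
       <= nrm (v - lincomb e a) * N y) ->
  (forall (y : 'rV[R]_m) C, 0 <= C ->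
    (forall a, `|\sum_j y ord0 j * ip (lincomb e a) (g j)|
       <= C * nrm (lincomb e a)) ->
    c * N y <= C) ->
  exists F : V -> V,
  [/\ forall v, exists a, F v = lincomb e a,
      forall v w, D v -> D w -> (forall u, D u -> ip v u = ip w u) -> F v = F w,
      forall k v w, D v -> D w -> F (k *: v + w) = k *: F v + F w,
      forall v j, K v -> ip (F v) (g j) = ip v (g j) &
      forall v a, K v ->
        nrm (v - F v) <= (1 + c^-1) * nrm (v - lincomb e a)].
Proof.
move=> De Dg KD c0 bdd lbb.
have [P Priesz] := riesz De.
pose coef v : 'rV[R]_n := (\row_i ip v (e i)) *m P.
pose pr v := lincomb e (coef v).
have Dpr v : D (pr v) by exact: dom_lincomb.
have pr_orth v a : D v -> ip (pr v) (lincomb e a) = ip v (lincomb e a).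
  move=> Dv; have prE i : ip (pr v) (e i) = ip v (e i).
    rewrite Priesz ?mxE// => b b0.
    suff : `|\sum_i b ord0 i * (\row_i ip v (e i)) ord0 i| <= 0.
      by rewrite normr_le0 => /eqP.
    rewrite (eq_bigr (fun i => b ord0 i * ip (e i) v)); last first.
      by move=> j _; rewrite mxE (ip_sym S).
    rewrite -ip_lincombl//.
    by rewrite (le_trans (cauchy_schwarz (dom_lincomb b De) Dv))// b0 mul0r.
  rewrite (ip_sym S) ip_lincombl// (ip_sym S v) ip_lincombl//.
  by apply: eq_bigr => i _; rewrite (ip_sym S) prE (ip_sym S).
pose r j := pr (g j).
have Dr j : D (r j) by exact: Dpr.
have rE a j : ip (lincomb e a) (r j) = ip (lincomb e a) (g j).
  by rewrite (ip_sym S) pr_orth// (ip_sym S).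
have lbb_r y : N y <= c^-1 * nrm (lincomb r y).
  rewrite ler_pdivlMl//; apply: lbb; first exact: nrm_ge0.
  move=> a; rewrite mulrC (eq_bigr (fun j => y ord0 j * ip (r j) (lincomb e a))).
    rewrite -ip_lincombl//; last exact: dom_lincomb.
    rewrite (ip_sym S); exact: cauchy_schwarz (dom_lincomb _ _) (dom_lincomb _ _).
  by move=> j _; rewrite -rE (ip_sym S).
(* The correction cor u lies in the span of the r j, and has the same pairings
   with them as u has with the g j. *)
have [Q Qriesz] := riesz Dr.
pose scoef u : 'rV[R]_m := (\row_j ip u (g j)) *m Q.
pose cor u := lincomb r (scoef u).
have cor_span u : exists a, cor u = lincomb e a.
  exists (\sum_j scoef u ord0 j *: coef (g j)).
  apply: (big_ind2 (fun x a => x = lincomb e a)) => [|x a y b -> ->|j _].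
  - by rewrite -[0 in RHS](scaler0 _ 1) /lincomb big1// => i _; rewrite !mxE mulr0 scale0r.
  - by rewrite -[a]scale1r lincombP !scale1r.
  - by rewrite -[X in lincomb e X]addr0 lincombP [X in _ + X]big1 ?addr0// => i _; rewrite mxE scale0r.
have Dcor u : D (cor u) by exact: dom_lincomb.
have corE v j : K v -> ip (cor (v - pr v)) (g j) = ip (v - pr v) (g j).
  move=> Kv; have [a aE] := cor_span (v - pr v).
  rewrite aE -rE -aE Qriesz ?mxE// => y y0.
  apply/eqP; rewrite -normr_le0.
  rewrite (eq_bigr (fun j => y ord0 j * ip (v - pr v) (g j))); last first.
    by move=> k _; rewrite mxE.
  apply: (le_trans (bdd v (coef v) y Kv)).
  by rewrite mulr_ge0_le0 ?nrm_ge0// (le_trans (lbb_r y))// y0 mulr0.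
have cor_le v : K v -> nrm (cor (v - pr v)) <= c^-1 * nrm (v - pr v).
  move=> Kv; set u := v - pr v.
  have [z|nz] := eqVneq (nrm (cor u)) 0.
    by rewrite z mulr_ge0 ?nrm_ge0// invr_ge0 ltW.
  have np : 0 < nrm (cor u) by rewrite lt_neqAle eq_sym nz nrm_ge0.
  (* |cor u|^2 pairs u with the g j with the coefficients of cor u itself,
     which bdd and lbb_r bound by c^-1 |u| |cor u|. *)
  rewrite -(ler_pM2r np) -expr2 nrm_sqr// {1}/cor ip_lincombl//.
  have [a aE] := cor_span u.
  rewrite (eq_bigr (fun j => scoef u ord0 j * ip u (g j))); last first.
    move=> j _; congr (_ * _).
    by rewrite (ip_sym S) aE rE -aE corE.
  apply: (le_trans (ler_norm _)); apply: (le_trans (bdd v (coef v) _ Kv)).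
  rewrite -/(pr v) -/u [c^-1 * _]mulrC -mulrA ler_wpM2l ?nrm_ge0//.
exists (fun v => pr v + cor (v - pr v)); split.
- move=> v; have [a ->] := cor_span (v - pr v).
  by exists (coef v + a); rewrite -[coef v]scale1r lincombP !scale1r.
- move=> v w Dv Dw vw.
  have prE : pr v = pr w.
    by rewrite /pr /coef; congr (lincomb _ (_ *m _)); apply/rowP => i; rewrite !mxE vw.
  rewrite prE; congr (_ + lincomb _ (_ *m _)); apply/rowP => j; rewrite !mxE.
  by rewrite !ipBl// vw.
- move=> k v w Dv Dw.
  have prD : pr (k *: v + w) = k *: pr v + pr w.
    rewrite /pr -lincombP; congr lincomb; rewrite /coef scalemxAl -mulmxDl.
    by congr (_ *m _); apply/rowP => i; rewrite !mxE (ip_linear S).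
  rewrite prD scalerDr addrACA; congr (_ + _).
  rewrite /cor -[RHS]lincombP; congr (lincomb _ _); rewrite /scoef scalemxAl -mulmxDl.
  congr (_ *m _); apply/rowP => j; rewrite !mxE opprD addrACA -scalerBr.
  by rewrite (ip_linear S)//; exact: domB.
- move=> v j Kv; have Dv := KD _ Kv.
  by rewrite ipDl// corE// ipBl// addrC subrK.
- move=> v a Kv; have Dv := KD _ Kv.
  have -> : v - (pr v + cor (v - pr v)) = (v - pr v) + (-1) *: cor (v - pr v).
    by rewrite scaleN1r opprD addrA.
  have Du : D (v - pr v) by exact: domB.
  apply: (le_trans (nrmD Du (domZ _ (Dcor _)))).
  have -> : nrm (-1 *: cor (v - pr v)) = nrm (cor (v - pr v)).
    by rewrite /nrm ipZl ?ipZr// ?mulN1r ?opprK//; exact: domZ.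
  have h : nrm (v - pr v) <= nrm (v - lincomb e a).
    have -> : v - lincomb e a = (v - pr v) + (pr v - lincomb e a) by rewrite addrA subrK.
    apply: pythagoras_le => //; first exact/domB/dom_lincomb.
    have -> : pr v - lincomb e a = lincomb e (-1 *: a + coef v).
      by rewrite lincombP scaleN1r addrC.
    by rewrite ipBl// ?pr_orth ?subrr//; exact: dom_lincomb.
  apply: (le_trans (lerD (lexx _) (cor_le _ Kv))).
  rewrite -{1}[nrm _]mul1r -mulrDl ler_wpM2l// addr_ge0// invr_ge0 ltW//.
Qed.
End semi_inner_theory.

(** * Open sets, continuous functions and volumes in R^n *)

Definition rV_cube {R : realType} n (c : 'rV[R]_n) (r : R) : set 'rV[R]_n :=
  [set x | forall i, `|x ord0 i - c ord0 i| < r].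

(** Cubes link the two structures on R^n: they are the balls of its topology, and
    finite intersections of preimages of intervals by the coordinates, which
    generate the sigma-algebra. *)
Lemma measurable_rV_cube {R : realType} n (c : 'rV[R]_n) (r : R) :
  measurable (rV_cube c r).
Proof.
have -> : rV_cube c r =
    \bigcap_(i : 'I_n) (@rV_coord R n i @^-1` ball (c ord0 i) r).
  apply/seteqP; split => [x cx i _|x xI i].
    by rewrite /= -ball_normE /= distrC; exact: cx.
  by have := xI i Logic.I; rewrite /= -ball_normE /= distrC.
apply: fin_bigcap_measurable => // i _; rewrite -[X in measurable X]setTI.
by apply: measurable_rV_coord => //; exact: measurable_ball.
Qed.

Lemma rV_cube_ball {R : realType} n (c : 'rV[R]_n) (r : R) : 0 < r ->
  rV_cube c r = ball c r.
Proof.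
move=> r0; apply/seteqP; split => x.
- by move=> cx; split => // i j; rewrite ord1 -ball_normE /= distrC; exact: cx.
- by move=> [_ xI] i; have := xI ord0 i; rewrite -ball_normE /= distrC.
Qed.

(** An open set is a union of cubes with rational center and radius 1/(k+1), of
    which there are countably many. *)
Lemma open_measurable_rV {R : realType} n (U : set 'rV[R]_n) :
  open U -> measurable U.
Proof.
move=> oU.
pose I := ('rV[rat]_n * nat)%type.
pose ctr (p : I) : 'rV[R]_n := map_mx ratr p.1.
pose F (p : I) := if pselect (rV_cube (ctr p) p.2.+1%:R^-1 `<=` U) then
  rV_cube (ctr p) p.2.+1%:R^-1 else set0.
have -> : U = \bigcup_p F p.
  apply/seteqP; split => [x Ux|x [p _]]; last first.
    by rewrite /F; case: pselect => // pU /pU.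
  (* A cube of radius below e / 2 around a rational point that contains x is
     within distance e of x. *)
  have [e/= e0 eU] : nbhs_ball x U by rewrite nbhs_ballE; exact: open_nbhs_nbhs.
  have [k ke] : exists k : nat, k.+1%:R^-1 < e / 2.
    have e20 : 0 < e / 2 by rewrite divr_gt0.
    have [k ke] := ltr_add_invr e20.
    by exists k; rewrite add0r in ke.
  have k0 : 0 < k.+1%:R^-1 :> R by rewrite invr_gt0.
  have /choice[q qx] : forall i : 'I_n, exists q : rat,
      `|x ord0 i - ratr q| < k.+1%:R^-1.
    move=> i.
    have [z [/= xq [q _ qE]]] : ball (x ord0 i) k.+1%:R^-1 `&` range ratr !=set0.
      apply: dense_rat; last exact: ball_open.
      by exists (x ord0 i); exact: ballxx.
    by exists q; rewrite qE; rewrite -ball_normE in xq.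
  exists (\row_i q i, k) => //; rewrite /F; case: pselect => /= [_|].
    by move=> i; rewrite !mxE.
  case=> y yq; apply: eU; rewrite -rV_cube_ball// => i.
  have := qx i; have := yq i; rewrite !mxE.
  move=> yz xz; apply: (le_lt_trans (ler_distD (ratr (q i)) _ _)).
  rewrite [X in _ + X]distrC (splitr e).
  by rewrite ltrD ?(lt_trans _ ke).
apply: countable_bigcupT_measurable => [|p]; first exact: countableP.
by rewrite /F; case: pselect => [?|?]; [exact: measurable_rV_cube|exact: measurable0].
Qed.

Lemma continuous_measurable_rV {R : realType} n (f : 'rV[R]_n -> R) :
  continuous f -> measurable_fun [set: 'rV[R]_n] f.
Proof.
move=> /continuousP cf.
apply: (measurability _ (RGenOpens.measurableE R)).
move=> _ [_ [a [b ->] <-]]; rewrite setTI; apply: open_measurable_rV.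
exact/cf/interval_open.
Qed.

Lemma leb_rV_cube_lty {R : realType} n (r : R) :
  (leb n (rV_cube (0 : 'rV[R]_n) r) < +oo)%E.
Proof.
elim: n => [|n IH]; first by rewrite /= diracE ltry.
rewrite /= /rV_cons_measure /pushforward.
have -> : @rV_cons R n @^-1` rV_cube 0 r = ball (0 : R) r `*` rV_cube 0 r.
  apply/seteqP; split => -[a u].
  - move=> h; split.
      by have := h ord0; rewrite /= !mxE unlift_none /= -ball_normE /= distrC.
    by move=> i; have := h (lift ord0 i); rewrite /= !mxE liftK.
  - move=> [/= ha hu] i; rewrite !mxE; case: unliftP => [j _|_] /=.
      by have := hu j; rewrite !mxE.
    by move: ha; rewrite -ball_normE /= distrC.
rewrite product_measure1E//; last first.
- exact: measurable_rV_cube.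
- exact: measurable_ball.
have [r0|r0] := ltP r 0.
  by rewrite (_ : ball _ _ = set0) ?measure0 ?mul0e// ball0//; exact: ltW.
rewrite [X in (X * _)%E](_ : _ = (r *+ 2)%:E); last exact: lebesgue_measure_ball.
rewrite lte_mul_pinfty// ?lee_fin ?mulrn_wge0//.
Qed.

Lemma bounded_leb_lty {R : realType} n (A : set 'rV[R]_n) :
  measurable A -> bounded_set A -> (leb n A < +oo)%E.
Proof.
move=> mA [M [Mreal AM]].
have M1 : M < `|M| + 1 by rewrite (le_lt_trans (ler_norm M))// ltrDl.
apply: (@le_lt_trans _ _ (leb n (rV_cube (0 : 'rV[R]_n) (`|M| + 2)))).
  apply: le_measure; rewrite ?inE//; first exact: measurable_rV_cube.
  move=> x Ax; rewrite rV_cube_ball ?ltr_wpDl//.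
  by rewrite -ball_normE /= sub0r normrN (le_lt_trans (AM _ M1 _ Ax))// ltrD2l ltr1n.
exact: leb_rV_cube_lty.
Qed.

(** * The space L2 on Om *)

Section L2_spaces.
Context {R : realType} (d : nat) (Om : set 'rV[R]_d).
Local Notation E := 'rV[R]_d.
Implicit Types (f g : E -> R) (v w : E -> E).

Definition L2ip f g : R := \int[leb d]_(x in Om) (f x * g x).

(** Extension by zero turns integrals on Om into integrals on the whole space, where
    the theory of L^p functions applies. *)
Lemma L2ipE f g : L2ip f g = \int[leb d]_x ((f \_ Om) x * (g \_ Om) x).
Proof.
rewrite /L2ip Rintegral_mkcond; apply: eq_Rintegral => x _.
by rewrite !patchE; case: ifP => // _; rewrite mulr0.
Qed.

Let le1_2 : (1 <= 2%:E :> \bar R)%E. Proof. by rewrite lee_fin ler1n. Qed.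

Lemma L2_linear a f g : L2 Om f -> L2 Om g -> L2 Om (a *: f + g).
Proof.
rewrite /L2 => Lf Lg.
rewrite (_ : (a *: f + g) \_ Om = a *: (f \_ Om) + g \_ Om).
  by have [_] := Lfun_submod_closed (leb d) le1_2; exact.
apply/funext => x; rewrite -[RHS]/(a * (f \_ Om) x + (g \_ Om) x) !patchE.
by case: ifP => // _; rewrite mulr0 addr0.
Qed.

Lemma L2_0 : L2 Om 0.
Proof.
rewrite /L2 (_ : 0 \_ Om = 0).
  by have [] := Lfun_submod_closed (leb d) le1_2.
by apply/funext => x; rewrite patchE; case: ifP.
Qed.

Lemma L2_integrableM f g : L2 Om f -> L2 Om g ->
  (leb d).-integrable setT (EFin \o (fun x => (f \_ Om) x * (g \_ Om) x)).
Proof. by move=> Lf Lg; apply/Lfun1_integrable; exact: Lfun2_mul_Lfun1. Qed.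

Lemma L2_semi_inner : semi_inner (L2 Om) L2ip.
Proof.
split.
- exact: L2_0.
- exact: L2_linear.
- move=> a u v w Lu Lv Lw; rewrite !L2ipE.
  rewrite -RintegralZl//; last exact: L2_integrableM.
  rewrite -RintegralD//; last exact: L2_integrableM.
    apply: eq_Rintegral => x _; rewrite !patchE.
    by case: ifP => _; rewrite /= ?mulr0 ?addr0// mulrDl mulrA.
  have := @integrableZl _ _ _ (leb d) _ measurableT a _ (L2_integrableM Lu Lw).
  by [].
- by move=> u v; apply: eq_Rintegral => x _; rewrite mulrC.
- by move=> u Lu; apply: Rintegral_ge0 => x _; rewrite -expr2 sqr_ge0.
Qed.

Lemma L2_measurable f : L2 Om f -> measurable_fun setT (f \_ Om).
Proof. by move=> /andP[+ _]; rewrite inE. Qed.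

Lemma L2norm_ge0 f : 0 <= L2norm Om f.
Proof. by rewrite fine_ge0// Lnorm_ge0. Qed.

Lemma L2normE f : L2 Om f -> L2norm Om f = nrm L2ip f.
Proof.
move=> Lf; rewrite /nrm.
suff -> : L2ip f f = L2norm Om f ^+ 2 by rewrite sqrtr_sqr ger0_norm// L2norm_ge0.
have fN : ('N[leb d]_2%:E[EFin \o (f \_ Om)] \is a fin_num)%E.
  by rewrite ge0_fin_numE ?Lnorm_ge0//; move: Lf => /andP[_]; rewrite inE.
have n20 : 2 != 0 :> R by rewrite pnatr_eq0.
have := poweR_Lnorm (leb d) (EFin \o (f \_ Om)) n20.
rewrite -(fineK fN) poweR_EFin powR_mulrn ?L2norm_ge0// => N2.
rewrite L2ipE /Rintegral -[RHS]/(fine (L2norm Om f ^+ 2)%:E) N2.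
congr fine; apply: eq_integral => x _.
rewrite /= powR_mulrn// real_normK ?num_real// expr2.
Qed.

Lemma L2_eq0 f : L2 Om f -> nrm L2ip f = 0 -> ae_eq (leb d) setT (f \_ Om) (cst 0).
Proof.
move=> Lf; rewrite -L2normE// /L2norm => N0.
have N0' : ('N[leb d]_2%:E[EFin \o (f \_ Om)] = 0)%E.
  rewrite -[LHS]fineK ?N0// ge0_fin_numE ?Lnorm_ge0//.
  by move: Lf => /andP[_]; rewrite inE.
have : ae_eq (leb d) setT (EFin \o (f \_ Om)) (cst 0%E).
  by apply: Lnorm_eq0_eq0 N0' => //; apply/measurable_EFinP; exact: L2_measurable.
by apply: filterS => x /[apply] -[].
Qed.

Lemma L2_eq0_aeq f : L2 Om f -> nrm L2ip f = 0 -> aeq Om f 0.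
Proof.
move=> Lf /(L2_eq0 Lf); apply: filterS => x /(_ Logic.I) fx Ox.
by rewrite -[RHS]fx// patchE mem_set.
Qed.

Lemma aeq_L2ip f f' g : L2 Om f -> L2 Om f' -> L2 Om g ->
  aeq Om f f' -> L2ip f g = L2ip f' g.
Proof.
move=> Lf Lf' Lg ff'; rewrite !L2ipE /Rintegral; congr fine.
apply: ae_eq_integral => //.
- by have /measurable_int := L2_integrableM Lf Lg.
- by have /measurable_int := L2_integrableM Lf' Lg.
- apply: filterS ff' => x fx _; congr (_%:E); congr (_ * _).
  by rewrite !patchE; case: ifPn => // /set_mem; exact: fx.
Qed.

(** This is why test functions, and their partial derivatives, can be paired with
    L2 functions on Om. *)
Lemma continuous_L2 f : open Om -> bounded_set Om -> continuous f -> L2 Om f.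
Proof.
move=> oOm bOm cf; have mOm := open_measurable_rV oOm.
have mf : measurable_fun setT (f \_ Om).
  apply/(measurable_restrictT _ _).1 => //.
  exact: measurable_funTS (continuous_measurable_rV cf).
have [r r0 Or] : exists2 r, 0 < r & Om `<=` closed_ball (0 : E) r.
  have [r [_ rO]] := bOm; exists (`|r| + 1); first by rewrite ltr_wpDl.
  move=> x Ox; rewrite closed_ballE ?ltr_wpDl// /closed_ball_ /= sub0r normrN.
  by apply: rO Ox; rewrite (le_lt_trans (ler_norm r))// ltrDl.
have [M [Mreal fM]] : bounded_set (f @` closed_ball (0 : E) r).
  apply: compact_bounded; apply: continuous_compact.
    exact: continuous_subspaceT.
  apply: bounded_closed_compact; last exact: closed_ball_closed.
  exists r; split; first exact: num_real.
  move=> t rt x; rewrite closed_ballE// /closed_ball_ /= sub0r normrN => /le_trans.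
  by apply; exact: ltW.
have M1 : M < `|M| + 1 by rewrite (le_lt_trans (ler_norm M))// ltrDl.
set B := `|M| + 1 in M1.
have fB x : Om x -> `|f x| <= B.
  by move=> Ox; apply: (fM _ M1); exists x => //; exact: Or.
rewrite /L2 inE; apply/andP; split; rewrite inE//= /finite_norm unlock /Lnorm.
apply: poweR_lty.
apply: (@le_lt_trans _ _ (\int[leb d]_(x in Om) (B `^ 2)%:E)%E).
  rewrite [leRHS]integral_mkcond; apply: ge0_le_integral => //=.
  - apply/measurable_EFinP; apply: (measurableT_comp (measurable_powR _)) => //.
    exact: measurableT_comp.
  - apply/(measurable_restrictT _ _).1 => //; exact: measurable_cst.
  - move=> x _; rewrite !patchE; case: ifPn => [/set_mem Ox|_].
      by rewrite lee_fin ge0_ler_powR ?nnegrE// ?fB// (le_trans _ (fB _ Ox)).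
    by rewrite normr0 powR0.
rewrite integral_cst// lte_mul_pinfty ?lee_fin ?powR_ge0//.
exact: bounded_leb_lty.
Qed.

End L2_spaces.

(** * Vector fields and integration by parts *)

Section vector_fields.
Context {R : realType} (d : nat) (Om : set 'rV[R]_d).
Local Notation E := 'rV[R]_d.
Implicit Types (f g q : E -> R) (u v w : E -> E).
Local Notation L2ip := (L2ip Om).
Let S2 := L2_semi_inner Om.

Definition vL2 v : Prop := forall i, L2 Om (Defs.comp v i).

Definition vL2ip v w : R := \sum_i L2ip (Defs.comp v i) (Defs.comp w i).

Lemma comp_linear a v w i : Defs.comp (a *: v + w) i = a *: Defs.comp v i + Defs.comp w i.
Proof. by apply/funext => x; rewrite /Defs.comp !mxE. Qed.

Lemma vL2_semi_inner : semi_inner vL2 vL2ip.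
Proof.
split.
- move=> i; rewrite (_ : Defs.comp 0 i = 0); first exact: L2_0.
  by apply/funext => x; rewrite /Defs.comp mxE.
- by move=> a v w Lv Lw i; rewrite comp_linear; exact: L2_linear.
- move=> a u v w Lu Lv Lw; rewrite /vL2ip mulr_sumr -big_split /=.
  by apply: eq_bigr => i _; rewrite comp_linear (ip_linear S2).
- by move=> u v; apply: eq_bigr => i _; exact: (ip_sym S2).
- by move=> u Lu; apply: sumr_ge0 => i _; exact: (ip_ge0 S2).
Qed.

Lemma vL2normE v : vL2 v -> vL2norm Om v = nrm vL2ip v.
Proof.
move=> Lv; rewrite /vL2norm /nrm; congr Num.sqrt; apply: eq_bigr => i _.
by rewrite L2normE// (nrm_sqr S2).
Qed.

Lemma vL2_eq_aeq v w : vL2 v -> vL2 w -> nrm vL2ip (v - w) = 0 -> aeq Om v w.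
Proof.
move=> Lv Lw vw0; have Lvw := domB vL2_semi_inner Lv Lw.
have vwi i : aeq Om (Defs.comp (v - w) i) 0.
  apply: L2_eq0_aeq => //; rewrite /nrm.
  have /eqP := nrm_sqr vL2_semi_inner Lvw; rewrite vw0 expr0n eq_sym /vL2ip.
  rewrite psumr_eq0 => [/allP/(_ i)|j _]; last exact: (ip_ge0 S2).
  by rewrite mem_index_enum => /(_ isT)/eqP ->; rewrite sqrtr0.
have : \forall x \ae leb d, forall i, Om x -> Defs.comp (v - w) i x = 0.
  by apply: filter_forall => i; exact: vwi.
apply: filterS => x h Ox; apply/rowP => i; have := h i Ox.
by rewrite /Defs.comp !mxE => /subr0_eq.
Qed.

Lemma aeq_vL2ip v v' w : vL2 v -> vL2 v' -> vL2 w ->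
  aeq Om v v' -> vL2ip v w = vL2ip v' w.
Proof.
move=> Lv Lv' Lw vv'; apply: eq_bigr => i _; apply: aeq_L2ip => //.
by apply: filterS vv' => x /[apply] vx; rewrite /Defs.comp vx.
Qed.

Lemma wpartialP i f : H1 Om f ->
  L2 Om (wpartial Om i f) /\ is_wpartial Om i f (wpartial Om i f).
Proof.
move=> [_ /(_ i)[g Lg fg]]; rewrite /wpartial.
by apply: (@getPex _ [set g | L2 Om g /\ is_wpartial Om i f g]); exists g.
Qed.

Lemma test_function_L2 p : open Om -> bounded_set Om -> test_function Om p ->
  L2 Om p /\ forall i, L2 Om (partial i p).
Proof.
move=> oOm bOm [sp _ _]; split.
  by apply: continuous_L2 => //; have [] := sp [::].
by move=> i; apply: continuous_L2 => //; have [] := sp [:: i].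
Qed.

(** For a test function p in place of f this is the definition of the weak derivative
    of q. Both sides are continuous in f for the H1 norm, so density of the
    test functions in H10 gives the rest. *)
Lemma H10_parts i f q : open Om -> bounded_set Om -> H10 Om f -> H1 Om q ->
  L2ip (wpartial Om i f) q = - L2ip f (wpartial Om i q).
Proof.
move=> oOm bOm [Hf happ] Hq.
have [Lf _] := Hf; have [Lq _] := Hq.
have [Ldf _] := wpartialP i Hf; have [Ldq dq] := wpartialP i Hq.
apply/eqP; rewrite -subr_eq0 opprK -normr_le0 leNgt; apply/negP.
set s := `|_| => s0.
(* A defect s > 0 would be at most e * C for every e > 0; e = s / (C + 1)
   refutes this. *)
pose C := nrm L2ip q + nrm L2ip (wpartial Om i q).
have C0 : 0 <= C by rewrite addr_ge0 ?nrm_ge0.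
have C1 : 0 < C + 1 by rewrite ltr_wpDl.
have [p [tp fp dfp]] := happ (s / (C + 1)) (divr_gt0 s0 C1).
have [Lp Ldp] := test_function_L2 oOm bOm tp.
have Lfp : L2 Om (f - p) by exact: (domB S2).
have Ldfp : L2 Om (wpartial Om i f - partial i p) by exact: (domB S2).
have : s <= s / (C + 1) * C.
  rewrite {1}/s.
  have -> : L2ip (wpartial Om i f) q + L2ip f (wpartial Om i q) =
      L2ip (wpartial Om i f - partial i p) q + L2ip (f - p) (wpartial Om i q).
    rewrite !(ipBl S2)// [L2ip (partial i p) q](ip_sym S2).
    rewrite [L2ip p _](ip_sym S2).
    rewrite [L2ip q (partial i p)](dq _ tp) -/(L2ip _ _). ring.
  rewrite (le_trans (ler_normD _ _))// mulrDr lerD//.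
  - rewrite (le_trans (cauchy_schwarz S2 Ldfp Lq))// ler_wpM2r ?nrm_ge0//.
    by rewrite -L2normE//; exact: ltW (dfp i).
  - rewrite (le_trans (cauchy_schwarz S2 Lfp Ldq))// ler_wpM2r ?nrm_ge0//.
    by rewrite -L2normE//; exact: ltW.
rewrite leNgt mulrAC ltr_pdivrMr// ltr_pM2l// ltrDl//.
by rewrite ltr01.
Qed.

Lemma vH10_vL2 v : vH10 Om v -> vL2 v.
Proof. by move=> Hv i; have [[]] := Hv i. Qed.

Lemma grad_vL2 q : H1 Om q -> vL2 (grad Om q).
Proof.
move=> Hq i; rewrite (_ : Defs.comp _ _ = wpartial Om i q); first by case: (wpartialP i Hq).
by apply/funext => x; rewrite /Defs.comp /grad mxE.
Qed.

Lemma divE v : div Om v = \sum_i wpartial Om i (Defs.comp v i).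
Proof. by apply/funext => x; rewrite fct_sumE. Qed.

Lemma div_L2 v : vH10 Om v -> L2 Om (div Om v).
Proof.
move=> Hv; rewrite divE; apply: (big_ind (L2 Om)) => [|f g|i _].
- exact: L2_0.
- exact: (domD S2).
- by have [] := wpartialP i (Hv i).1.
Qed.

Lemma div_parts v q : open Om -> bounded_set Om -> vH10 Om v -> H1 Om q ->
  L2ip (div Om v) q = - vL2ip v (grad Om q).
Proof.
move=> oOm bOm Hv Hq; have Lq := Hq.1.
have Ld i : L2 Om (wpartial Om i (Defs.comp v i)) by have [] := wpartialP i (Hv i).1.
have dE : div Om v = lincomb (fun i => wpartial Om i (Defs.comp v i)) (const_mx 1).
  by rewrite divE; apply: eq_bigr => i _; rewrite mxE scale1r.
rewrite dE (ip_lincombl S2)// /vL2ip -sumrN; apply: eq_bigr => i _.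
rewrite mxE mul1r (H10_parts i oOm bOm (Hv i) Hq).
by congr (- L2ip _ _); apply/funext => x; rewrite /Defs.comp mxE.
Qed.

End vector_fields.

(** * The Fortin projection on one mesh *)

Lemma fin_dim_subspaceP {R : realType} (V : lmodType R) (X : set V) :
  fin_dim_subspace X -> exists n (e : 'I_n -> V), [/\ forall i, X (e i),
    forall a, X (lincomb e a) & forall v, X v -> exists a, v = lincomb e a].
Proof.
move=> [n [e XE]]; exists n, e.
have Xl a : X (lincomb e a) by rewrite XE; exists (a ord0).
split=> // [i|v]; last first.
  rewrite XE => -[a ->]; exists (\row_i a i).
  by apply: eq_bigr => i _; rewrite mxE.
rewrite (_ : e i = lincomb e (delta_mx ord0 i)); first exact: Xl.
rewrite /lincomb (bigD1 i)//= mxE !eqxx scale1r big1 ?addr0// => j ji.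
by rewrite mxE (negPf ji) andbF scale0r.
Qed.

Section fixed_mesh.
Context {R : realType} (d : nat) (Om : set 'rV[R]_d).
Local Notation E := 'rV[R]_d.
Implicit Types (q : E -> R) (v w : E -> E).

(** The hypothesis 0 <= C covers the two default values: the supremum of an empty set
    of quotients, and a quotient with denominator 0, are both 0. *)
Lemma lbb_sup_le (X : set (E -> E)) q (C : R) : 0 <= C ->
  (forall v, X v -> \int[leb d]_(x in Om) (div Om v x * q x) <= C * vL2norm Om v) ->
  lbb_sup Om X q <= C.
Proof.
move=> C0 XC; rewrite /lbb_sup; set S := [set _ | _ in _].
have [->|/set0P S0] := eqVneq S set0; first by rewrite sup0.
apply: ge_sup => // _ [v [Xv _] <-].
have := sqrtr_ge0 (\sum_i L2norm Om (Defs.comp v i) ^+ 2).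
rewrite -/(vL2norm Om v) le0r => /predU1P[->|n0]; first by rewrite invr0 mulr0.
by rewrite ler_pdivrMr//; exact: XC.
Qed.

(** The weak gradient of a combination is chosen independently of those of its
    terms. Against H10 fields it nevertheless acts linearly, since its pairing
    with v is minus that of div v with the combination. *)
Lemma grad_lincomb_weak m (f : 'I_m -> E -> R) v (y : 'rV[R]_m) :
  open Om -> bounded_set Om -> vH10 Om v -> (forall j, H1 Om (f j)) ->
  H1 Om (lincomb f y) ->
  \sum_j y ord0 j * vL2ip Om v (grad Om (f j)) =
  vL2ip Om v (grad Om (lincomb f y)).
Proof.
move=> oOm bOm Hv Hf Hq; have S2 := L2_semi_inner Om.
apply: oppr_inj; rewrite -div_parts// (ip_sym S2) (ip_lincombl S2)//; last exact: div_L2.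
  rewrite -sumrN; apply: eq_bigr => j _.
  by rewrite -mulrN -div_parts// (ip_sym S2).
by move=> j; have [] := Hf j.
Qed.

(** For a single mesh the estimate is comparison with any x in X: idempotency is the
    case v = x, and approximation properties of X enter only through a good
    choice of x. *)
Lemma fortin_quasi_optimal (X : set (E -> E)) (M : set (E -> R)) (c : R) :
  open Om -> bounded_set Om ->
  fin_dim_subspace X -> X `<=` vH10 Om ->
  fin_dim_subspace M -> M `<=` H1 Om ->
  0 < c -> (forall q, M q -> c * vL2norm Om (grad Om q) <= lbb_sup Om X q) ->
  exists2 F, fortin_projection Om X M F &
    forall v x, vH10 Om v -> X x ->
      vL2norm Om (v - F v) <= (1 + c^-1) * vL2norm Om (v - x).
Proof.
move=> oOm bOm /fin_dim_subspaceP[n [e [Xe Xl lX]]] XH.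
move=> /fin_dim_subspaceP[m [f [Mf Ml lM]]] MH c0 lbb.
have S := vL2_semi_inner Om; have S2 := L2_semi_inner Om.
have HL := @vH10_vL2 _ _ Om.
pose N (y : 'rV[R]_m) := vL2norm Om (grad Om (lincomb f y)).
have weak v (y : 'rV[R]_m) : vH10 Om v -> \sum_j y ord0 j * vL2ip Om v (grad Om (f j)) =
    vL2ip Om v (grad Om (lincomb f y)).
  by move=> Hv; apply: grad_lincomb_weak => // [j|]; exact: MH.
have Lg y : vL2 Om (grad Om (lincomb f y)) by apply: grad_vL2; exact: MH.
have Lgf j : vL2 Om (grad Om (f j)) by apply: grad_vL2; exact: MH.
have bdd v a (y : 'rV[R]_m) : vH10 Om v ->
    `|\sum_j y ord0 j * vL2ip Om (v - lincomb e a) (grad Om (f j))|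
    <= nrm (vL2ip Om) (v - lincomb e a) * N y.
  move=> Hv; have Hx := XH _ (Xl a).
  have Lvx : vL2 Om (v - lincomb e a) by apply: (domB S); exact: HL.
  rewrite (_ : \sum_j _ = vL2ip Om (v - lincomb e a) (grad Om (lincomb f y))).
    by rewrite /N vL2normE//; exact: (cauchy_schwarz S).
  rewrite (ipBl S)//; [|exact: HL..].
  rewrite -!weak// -sumrB; apply: eq_bigr => j _.
  by rewrite (ipBl S) ?mulrBr//; exact: HL.
have lbb' (y : 'rV[R]_m) C : 0 <= C ->
    (forall a, `|\sum_j y ord0 j * vL2ip Om (lincomb e a) (grad Om (f j))|
      <= C * nrm (vL2ip Om) (lincomb e a)) -> c * N y <= C.
  move=> C0 yC; apply: (le_trans (lbb _ (Ml y))); apply: lbb_sup_le => // v Xv.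
  have [a va] := lX _ Xv; have Hv := XH _ Xv.
  rewrite -[leLHS]/(L2ip Om _ _) div_parts//; last exact: MH.
  rewrite -weak// vL2normE; last exact: HL.
  by rewrite va (le_trans _ (yC a))// (le_trans (ler_norm _))// normrN.
have [F [FX Faeq Flin Fg Fq]] := constrained_projection S (e := e)
  (g := fun j => grad Om (f j)) (fun i => HL _ (XH _ (Xe i))) Lgf HL c0 bdd lbb'.
have XF v : X (F v) by have [a ->] := FX v.
have HF v : vH10 Om (F v) by exact/XH/XF.
have Fopt v x : vH10 Om v -> X x ->
    vL2norm Om (v - F v) <= (1 + c^-1) * vL2norm Om (v - x).
  move=> Hv Xx; have [a ->] := lX _ Xx.
  rewrite !vL2normE; first exact: Fq.
    by apply: (domB S); apply: HL => //; exact: XH.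
  by apply: (domB S); apply: HL.
exists F => //; split.
- split; first split => //.
  + move=> v w Hv Hw vw; rewrite (Faeq v w); [exact: ae_eq_refl|exact: HL..|].
    by move=> u Lu; apply: aeq_vL2ip => //; exact: HL.
  + by move=> a v w Hv Hw; rewrite Flin; [exact: ae_eq_refl|exact: HL..].
- move=> v Hv; apply: ae_eq_sym; apply: vL2_eq_aeq; [exact: HL..|].
  apply/eqP; rewrite -vL2normE; last by apply: (domB S); exact: HL.
  rewrite eq_le sqrtr_ge0 andbT (le_trans (Fopt _ _ (HF v) (XF v)))//.
  rewrite subrr vL2normE; last exact: (dom0 S).
  by rewrite /nrm (ip0l S) ?sqrtr0 ?mulr0//; exact: (dom0 S).
- move=> v q Hv Mq; have [y qy] := lM _ Mq.
  rewrite -[LHS]/(L2ip Om (div Om v - div Om (F v)) q).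
  rewrite (ipBl S2); [|exact: div_L2..|by have [] := MH _ Mq].
  rewrite !div_parts//; [|exact: MH..].
  rewrite qy -!weak// -opprD -sumrB big1 ?oppr0// => j _.
  by rewrite -mulrBr Fg// subrr mulr0.
Qed.

End fixed_mesh.

(** * Families of meshes *)

Theorem theorem3p7 (R : realType) (d : nat) (Om : set 'rV[R]_d)
    (H : set R) (T : R -> seq 'M[R]_(d.+1, d))
    (X : R -> set ('rV[R]_d -> 'rV[R]_d)) (M : R -> set ('rV[R]_d -> R))
    (C : R -> ('rV[R]_d -> 'rV[R]_d) -> ('rV[R]_d -> 'rV[R]_d))
    (hd : d = 2%N \/ d = 3%N)
    (hOm : bounded_lipschitz_domain Om)
    (hT : triangulation_family Om H T)
    (hX : forall h, H h ->
       fin_dim_subspace (X h) /\ forall v, X h v -> vH10 Om v)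
    (hM : forall h, H h ->
       fin_dim_subspace (M h) /\
       forall q, M h q -> mean_zero_L2 Om q /\ H1 Om q)
    (hinvX : exists2 c : R, 0 < c & forall h v, H h -> X h v ->
       vH1norm Om v <= c * h^-1 * vL2norm Om v)
    (hinvM : exists2 c : R, 0 < c & forall h q, H h -> M h q ->
       H1norm Om q <= c * h^-1 * L2norm Om q)
    (hC : forall h, H h -> operator Om (X h) (C h))
    (happC : exists2 c : R, 0 < c & forall h v, H h -> vH10 Om v ->
       vL2norm Om (v - C h v) + h * vH1norm Om (C h v) <=
       c * h * vH1norm Om v)
    (hLBB : exists2 c : R, 0 < c & forall h q, H h -> M h q ->
       c * vL2norm Om (grad Om q) <= lbb_sup Om (X h) q) :
  exists2 c' : R, 0 < c' & forall h, H h ->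
    exists2 F : ('rV[R]_d -> 'rV[R]_d) -> ('rV[R]_d -> 'rV[R]_d),
      fortin_projection Om (X h) (M h) F &
      forall v, vH10 Om v ->
        vL2norm Om (v - F v) <= c' * h * vH1norm Om v.
Proof.
have [_ oOm _ bOm _] := hOm; have [hmesh _ _] := hT.
have [b b0 hb] := happC; have [c c0 hc] := hLBB.
have c1 : 0 < 1 + c^-1 by rewrite addr_gt0// invr_gt0.
exists ((1 + c^-1) * b) => [|h Hh]; first exact: mulr_gt0.
have [fX XH] := hX h Hh; have [fM MH] := hM h Hh.
have MH1 : M h `<=` H1 Om by move=> q /MH[].
have [F FF Fopt] := fortin_quasi_optimal oOm bOm fX XH fM MH1 c0 (fun q => hc h q Hh).
exists F => // v Hv; have [CX _] := hC h Hh; have [h0 _ _] := hmesh h Hh.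
rewrite (le_trans (Fopt v _ Hv (CX v Hv)))// -!mulrA ler_pM2l// mulrA.
rewrite (le_trans _ (hb h v Hh Hv))// lerDl mulr_ge0 ?sqrtr_ge0//.
exact: ltW.
Qed.
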